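(* Let $\mu \in \Pi$ be any prior policy independent of $H^t$ and let $\varepsilon$ be a uniform lower bound on $\{\pi_n(a)\}_{n=1}^t$ for all $a \in \mathcal{A}$. Then, for any $\beta \in (0,1)$, with probability no smaller than $1-\beta$ (over the sampling of $H^t$), we have that \begin{align*} |\bar{r}(\pi)-\hat{r}^{\mathrm{IS}}(\pi, H^t)| \leq \frac{1}{\varepsilon}\sqrt{\frac{D_{\mathrm{KL}}(\pi \,\|\, \mu) + \ln \frac{4 \,\mathrm{pi}}{3 \beta}}{t}}, \end{align*} holds simultaneously for all policy $\pi \in \Pi$ depending on $H^t$, where $\mathrm{pi}\approx 3.14159$ denotes the mathematical constant (not a policy).
   Context: Multi-armed bandit, offline setting: a logged dataset $H^t=\{(A_n,R_n)\}_{n=1}^t$ where each action $A_n\in\mathcal{A}$ is drawn from a known logging policy $\pi_n$ (which may depend on past data), and reward $R_n=R(A_n)\in[0,1]$ is drawn from a fixed unknown distribution given the action, with mean $\bar r(a)=\mathbb{E}[R(a)]$. $\Pi$ is a (compact) set of policies, i.e. probability distributions over $\mathcal{A}$. For a policy $\pi$, the expected reward is $\bar{r}(\pi)=\mathbb{E}_{A\sim\pi}[\bar r(A)]$. The importance sampling estimate is $\hat r^{\mathrm{IS}}(a,H^t)=\frac{1}{t}\sum_{n=1}^t \frac{\mathds{1}\{A_n=a\}}{\pi_n(A_n)}R_n$ and $\hat{r}^{\mathrm{IS}}(\pi,H^t)=\mathbb{E}_{A\sim\pi}[\hat r^{\mathrm{IS}}(A,H^t)]$. $D_{\mathrm{KL}}(\pi\|\mu)$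 is the relative entropy (KL divergence) of $\pi$ with respect to $\mu$. *)

(* Defs.v *)
From HB Require Import structures.
From mathcomp Require Import all_boot all_order all_algebra.
From mathcomp Require Import all_classical all_reals all_analysis.
Set Implicit Arguments. Unset Strict Implicit. Unset Printing Implicit Defensive.
Import Order.TTheory GRing.Theory Num.Theory.
Local Open Scope classical_set_scope.
Local Open Scope ring_scope.

Definition is_policy {R : realType} {A : finType} (p : A -> R) : Prop :=
  (forall a, 0 <= p a) /\ \sum_(a : A) p a = 1.

Definition KL {R : realType} {A : finType} (p q : A -> R) : \bar R :=
  if `[< exists a, 0 < p a /\ q a = 0 >] then +oo%E
  else (\sum_(a : A | 0 < p a) p a * ln (p a / q a))%:E.

(* generating pi-system of the sigma-algebra F_n of the history
   H^n = (A_m, R_m)_{m < n} (rounds are indexed 0,1,...,t-1) *)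
Definition cylinder {d} {Omega : measurableType d} {R : realType} {A : finType}
  (Acts : nat -> Omega -> A) (Rew : nat -> Omega -> R) (n : nat) : set (set Omega) :=
  [set C | exists (D : nat -> {set A}) (S : nat -> set R),
     (forall m, measurable (S m)) /\
     C = [set w | forall m, (m < n)%N -> Acts m w \in D m /\ S m (Rew m w)]].

(* The logged bandit process over t rounds:
   - pol n w is the logging policy of round n, a function of the past H^n,
   - given the past, A_n ~ pol n and R_n | A_n = a ~ nu a. *)
Definition bandit_process {d} {Omega : measurableType d} {R : realType} {A : finType}
  (P : probability Omega R) (nu : A -> probability R R)
  (pol : nat -> Omega -> A -> R) (Acts : nat -> Omega -> A) (Rew : nat -> Omega -> R)
  (t : nat) : Prop :=
  forall n, (n < t)%N ->
  [/\ forall a, measurable (Acts n @^-1` [set a]),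
      measurable_fun setT (Rew n),
      forall w, is_policy (pol n w),
      forall a (B : set R), measurable B ->
        <<s cylinder Acts Rew n >> ((fun w => pol n w a) @^-1` B)
    & forall C a (S : set R), cylinder Acts Rew n C -> measurable S ->
        P (C `&` Acts n @^-1` [set a] `&` Rew n @^-1` S) =
        ((\int[P]_(w in C) (pol n w a)%:E) * nu a S)%E ].

Definition rmean {R : realType} {A : finType} (nu : A -> probability R R) (a : A) : R :=
  fine (\int[nu a]_x (x%:E))%E.

Definition rbar {R : realType} {A : finType} (nu : A -> probability R R) (p : A -> R) : R :=
  \sum_(a : A) p a * rmean nu a.

Definition rIS_act {d} {Omega : measurableType d} {R : realType} {A : finType}
  (pol : nat -> Omega -> A -> R) (Acts : nat -> Omega -> A) (Rew : nat -> Omega -> R)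
  (t : nat) (w : Omega) (a : A) : R :=
  t%:R^-1 * \sum_(n < t) (if Acts n w == a then Rew n w / pol n w (Acts n w) else 0).

Definition rIS {d} {Omega : measurableType d} {R : realType} {A : finType}
  (pol : nat -> Omega -> A -> R) (Acts : nat -> Omega -> A) (Rew : nat -> Omega -> R)
  (t : nat) (w : Omega) (p : A -> R) : R :=
  \sum_(a : A) p a * rIS_act pol Acts Rew t w a.

(* Main.v *)
Require Import Defs.
From HB Require Import structures.
From mathcomp Require Import all_boot all_order all_algebra.
From mathcomp Require Import all_classical all_reals all_analysis.
From mathcomp Require Import measurable_realfun ring lra.
Import Order.TTheory GRing.Theory Num.Theory.
Import numFieldNormedType.Exports.
Local Open Scope classical_set_scope.
Local Open Scope ring_scope.

(** For a fixed action [a], the increments [1{A_n = a} R_n / pi_n(a)] lie in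
    [[0, 1/eps]] and have conditional mean [rmean a] given the past, so their
    centred sum [S a] over the [t] rounds is sub-Gaussian:
    [E exp (l S) <= exp (v l^2 / 2)] with [v = t / (4 eps^2)]. Integrating this
    bound in [l] against the normal law of variance [1 / (2 v)] (the method of
    mixtures) gives [E exp (S^2 / (4 v)) <= sqrt 2 <= 4 pi / 3]. By Markov's
    inequality, with probability at least [1 - beta] the [mu]-average of
    [exp (eps^2 S(a)^2 / t)] stays below [4 pi / (3 beta)]; on that event the
    Donsker-Varadhan inequality bounds the [p]-average of [eps^2 S(a)^2 / t] by
    [KL p mu + ln (4 pi / (3 beta))] for every [p] at once, and Jensen's
    inequality concludes. *)

Set Implicit Arguments. Unset Strict Implicit.

(** * Real inequalities *)

Lemma ge0_is_derive_ge0 (R : realType) (f df : R -> R) :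
  (forall x : R, 0 <= x -> is_derive x 1 f (df x)) ->
  (forall x, 0 <= x -> 0 <= df x) -> f 0 = 0 ->
  forall x, 0 <= x -> 0 <= f x.
Proof.
move=> fdf df0 f0 x x0.
have [||c] := @MVT_segment R f df 0 x x0.
- by move=> y; rewrite in_itv/= => /andP[/ltW y0 _]; exact: fdf.
- apply: derivable_within_continuous => y; rewrite in_itv/= => /andP[y0 _].
  exact: (@ex_derive _ _ _ _ _ _ _ (fdf y y0)).
- by rewrite in_itv/= => /andP[c0 _]; rewrite f0 !subr0 => ->; rewrite mulr_ge0 ?df0.
Qed.

(** Hoeffding's lemma for a Bernoulli variable. The gap [f] between the exponent on the right and
    the logarithm of the left side vanishes at 0, and so does its derivative [f1]; the second
    derivative is nonnegative, so two integrations from 0 give the sign of [f]. *)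
Lemma bernoulli_mgf_le_ge0 (R : realType) (m x : R) : 0 <= m <= 1 -> 0 <= x ->
  1 - m + m * expR x <= expR (x * m + x ^+ 2 / 8).
Proof.
move=> /andP[m0 m1] x0.
pose D (y : R) : R := 1 - m + m * expR y.
have D0 y : 0 < D y.
  rewrite /D; have := expR_gt0 y; move: m0; rewrite le_eqVlt => /predU1P[<-|m0] ey.
    lra.
  by rewrite ltr_wpDl ?subr_ge0// mulr_gt0.
have dD (y : R) : is_derive y 1 D (m * expR y).
  have -> : D = cst (1 - m) + m *: expR :> (R -> R) by apply/funext.
  by apply: is_derive_eq; rewrite add0r.
(* The derivative of [f], with [m * expR y / D y] rewritten as [1 - (1 - m) / D y]. *)
pose f1 (y : R) : R := y / 4 + m - 1 + (1 - m) * (D y)^-1.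
have f1_ge0 y : 0 <= y -> 0 <= f1 y.
  apply: (@ge0_is_derive_ge0 _ _
    (fun z => 4^-1 - (1 - m) * (m * expR z) / (D z) ^+ 2)) => [z _|z _|].
  - have -> : f1 = 4^-1 *: id + cst (m - 1) + (1 - m) *: (fun y => (D y)^-1) :> (R -> R).
      by apply/funext => u; rewrite /f1/= !fctE/= /GRing.scale/=; ring.
    have ? := is_deriveV (lt0r_neq0 (D0 z)) (dD z).
    apply: is_derive_eq; rewrite /GRing.scale/=.
    have := D0 z => ?; field; lra.
  (* AM-GM: the product of the two summands of [D z] is at most [(D z) ^+ 2 / 4]. *)
  - rewrite subr_ge0 ler_pdivrMr ?exprn_gt0// /D.
    have := sqr_ge0 (1 - m - m * expR z); lra.
  - rewrite /f1 /D expR0; have -> : 1 - m + m * 1 = 1 :> R by ring.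
    by rewrite invr1; ring.
pose f (y : R) : R := y * m + y ^+ 2 / 8 - ln (D y).
have f_ge0 : 0 <= f x.
  apply: (@ge0_is_derive_ge0 _ _ f1) x0 => [z z0|//|].
  - have -> : f = m *: id + 8^-1 *: (fun y => y ^+ 2) - (@ln R \o D) :> (R -> R).
      by apply/funext => u; rewrite /f/= !fctE/= /GRing.scale/=; ring.
    have ? := is_derive1_ln (D0 z).
    have ? := is_derive1_comp (is_derive1_ln (D0 z)) (dD z).
    apply: is_derive_eq; rewrite /GRing.scale/= /f1.
    have := D0 z; rewrite /D => ?; field; lra.
  - rewrite /f /D expR0; have -> : 1 - m + m * 1 = 1 :> R by ring.
    by rewrite ln1; ring.
rewrite -[leLHS](@lnK _ (D x)) ?posrE// ler_expR.
by rewrite -subr_ge0.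
Qed.

(** For negative [x], exchange the two outcomes: factoring out [expR x] turns [(m, x)] into
    [(1 - m, - x)]. *)
Lemma bernoulli_mgf_le (R : realType) (m x : R) : 0 <= m <= 1 ->
  1 - m + m * expR x <= expR (x * m + x ^+ 2 / 8).
Proof.
move=> m01; have [x0|x0] := leP 0 x; first exact: bernoulli_mgf_le_ge0.
have m01' : 0 <= 1 - m <= 1 by case/andP: m01 => *; apply/andP; split; lra.
have := @bernoulli_mgf_le_ge0 R (1 - m) (- x) m01'.
rewrite oppr_ge0 (ltW x0) => /(_ isT) h.
have -> : 1 - m + m * expR x = expR x * (1 - (1 - m) + (1 - m) * expR (- x)).
  rewrite mulrDr mulrCA -expRD subrr expR0; ring.
have -> : x * m + x ^+ 2 / 8 = x + (- x * (1 - m) + (- x) ^+ 2 / 8) by ring.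
by rewrite expRD ler_pM2l ?expR_gt0.
Qed.

Lemma expR_chord (R : realType) (l y : R) : 0 <= y <= 1 ->
  expR (l * y) <= 1 - y + y * expR l.
Proof.
move=> y01; have := @convex_expR R (Itv01 (andP y01).1 (andP y01).2) l 0.
rewrite !convRE/= expR0.
by rewrite mulr0 addr0 mulr1 mulrC addrC.
Qed.

(** Gibbs' inequality for [p] against the tilted law [mu * expR f / W], obtained from
    [ln z <= z - 1] on the support of [p]. Finiteness of the divergence makes [mu] positive
    there. *)
Lemma donsker_varadhan (R : realType) (A : finType) (p mu f : A -> R) :
  is_policy p -> is_policy mu -> (KL p mu < +oo)%E ->
  \sum_a p a * f a <= fine (KL p mu) + ln (\sum_a mu a * expR (f a)).
Proof.
move=> [p0 p1] [mu0 mu1]; rewrite /KL; case: ifPn => // /asboolPn pmu _ /=.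
set W := \sum_a mu a * expR (f a).
have pmu0 a : 0 < p a -> 0 < mu a.
  move=> pa; rewrite lt_neqAle mu0 andbT eq_sym; apply/eqP => mua.
  by apply: pmu; exists a.
have [a pa] : exists a, 0 < p a.
  apply: contrapT => /forallNP np; move: p1; rewrite big1 => [/esym/eqP|a _].
    by rewrite oner_eq0.
  by apply/eqP; rewrite eq_le p0 andbT leNgt; apply/negP/np.
have W0 : 0 < W.
  rewrite /W (bigD1 a)//= ltr_wpDr ?mulr_gt0 ?expR_gt0 ?pmu0//.
  by apply: sumr_ge0 => b _; rewrite mulr_ge0 ?expR_ge0.
have pE (g : A -> R) : \sum_b p b * g b = \sum_(b | 0 < p b) p b * g b.
  rewrite [RHS]big_mkcond; apply: eq_bigr => b _; case: ifPn => //.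
  by rewrite -leNgt => pb; rewrite (_ : p b = 0) ?mul0r//; apply/eqP; rewrite eq_le pb p0.
have psum : \sum_(b | 0 < p b) p b = 1.
  have := pE (fun=> 1); under eq_bigr do rewrite mulr1.
  by under [RHS]eq_bigr do rewrite mulr1; rewrite p1 => <-.
(* Weighting [ln W] by the total mass of [p] gathers the whole difference into one sum over the
   support. *)
rewrite pE -subr_le0 opprD addrA -sumrB -[ln W]mul1r -{1}psum mulr_suml -sumrB.
apply: (@le_trans _ _ (\sum_(b | 0 < p b) (mu b * expR (f b) / W - p b))).
  apply: ler_sum => b pb.
  have q0 : 0 < mu b * expR (f b) / W / p b.
    by rewrite !divr_gt0 ?mulr_gt0 ?expR_gt0 ?pmu0.
  have := @le_ln1Dx R (mu b * expR (f b) / W / p b - 1).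
  rewrite addrCA subrr addr0 ltrBrDl subrr => /(_ q0).
  have -> : ln (mu b * expR (f b) / W / p b) = f b - ln (p b / mu b) - ln W.
    rewrite !ln_div ?posrE ?divr_gt0 ?mulr_gt0 ?expR_gt0 ?pmu0//.
    by rewrite lnM ?posrE ?expR_gt0 ?pmu0// expRK; ring.
  move=> /(ler_wpM2l (ltW pb)).
  by rewrite !mulrBr mulr1 [p b * (_ / p b)]mulrC divfK ?gt_eqF.
(* The tilted law gives the support of [p] mass at most 1. *)
rewrite sumrB psum subr_le0 -mulr_suml ler_pdivrMr// mul1r /W.
rewrite big_mkcond/=; apply: ler_sum => b _; case: ifP => // _.
by rewrite mulr_ge0 ?expR_ge0.
Qed.

(** * Densities and sub-sigma-algebras *)

Section density_measure.
Context d (T : measurableType d) (R : realType).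
Variables (P : {finite_measure set T -> \bar R}) (u : T -> R) (c : R).
Hypotheses (mu : measurable_fun setT u) (u0c : forall x, 0 <= u x <= c).

(* The proofs are arguments so that the measure structure below can be inferred
   from the term itself. *)
Definition density_measure of measurable_fun setT u & (forall x, 0 <= u x <= c) :=
  fun C : set T => (\int[P]_(x in C) (u x)%:E)%E.

Local Notation nu := (density_measure mu u0c).

Let u0 x : 0 <= u x. Proof. by case/andP: (u0c x). Qed.
Let uc x : u x <= c. Proof. by case/andP: (u0c x). Qed.

Let density0 : nu set0 = 0%E.
Proof. by rewrite /density_measure integral_set0. Qed.

Let density_ge0 C : (0 <= nu C)%E.
Proof. by apply: integral_ge0 => x _; rewrite lee_fin. Qed.

Let density_sigma_additive : semi_sigma_additive nu.
Proof.
move=> F mF tF mUF; rewrite /density_measure ge0_integral_bigcup//.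
- apply: is_cvg_ereal_nneg_natsum_cond => n _ _.
  by apply: integral_ge0 => x _; rewrite lee_fin.
- by apply: measurable_funTS; exact/measurable_EFinP.
- by move=> x _; rewrite lee_fin.
Qed.

HB.instance Definition _ := isMeasure.Build _ _ _
  nu density0 density_ge0 density_sigma_additive.

Lemma integrable_density : P.-integrable setT (EFin \o u).
Proof.
apply: (@le_integrable _ _ _ _ _ measurableT _ (EFin \o cst c)).
- exact/measurable_EFinP.
- by move=> x _ /=; rewrite lee_fin ger0_norm ?(le_trans (uc x))// ler_norm.
- exact: finite_measure_integrable_cst.
Qed.

Let density_fin : fin_num_fun nu.
Proof.
move=> C mC; apply: integrable_fin_num => //.
exact: (integrableS measurableT mC (@subsetT _ C) integrable_density).
Qed.

HB.instance Definition _ := @Measure_isFinite.Build _ _ _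
  nu density_fin.

(** [u] is almost everywhere the Radon-Nikodym derivative of [nu], both having the same integral
    over every measurable set; the change of variables for that derivative then applies. *)
Lemma ge0_integral_density (h : T -> \bar R) : measurable_fun setT h ->
  (forall x, 0 <= h x)%E ->
  (\int[nu]_x h x = \int[P]_x (h x * (u x)%:E))%E.
Proof.
move=> mh h0.
have dom : nu `<< P.
  apply/null_content_dominatesP => C mC PC.
  by apply: null_set_integral => //; exact/measurable_funTS/measurable_EFinP.
rewrite -(Radon_Nikodym_SigmaFinite.change_of_variables dom)//.
apply: ae_eq_integral => //.
- apply: emeasurable_funM => //.
  exact: (measurable_int P (Radon_Nikodym_SigmaFinite.f_integrable dom)).
- by apply: emeasurable_funM => //; exact/measurable_EFinP.
- apply: ae_eqe_mul2l; apply: integral_ae_eq => //.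
  + exact: Radon_Nikodym_SigmaFinite.f_integrable.
  + exact/measurable_EFinP.
  + by move=> E _ mE; rewrite -Radon_Nikodym_SigmaFinite.f_integral.
Qed.

End density_measure.

(* If [u] and [v] have the same integrals over a pi-system generating a
   sub-sigma-algebra, they have the same conditional expectation given it. *)
Lemma ge0_integral_density_unique d (T : measurableType d) (R : realType)
    (P : {finite_measure set T -> \bar R}) (G : set (set T)) (u v : T -> R) (c : R) (h : T -> R) :
  G `<=` measurable -> setI_closed G -> G setT ->
  measurable_fun setT u -> measurable_fun setT v ->
  (forall x, 0 <= u x <= c) -> (forall x, 0 <= v x <= c) ->
  (forall C, G C -> \int[P]_(x in C) (u x)%:E = \int[P]_(x in C) (v x)%:E)%E ->
  measurable_fun setT (h : g_sigma_algebraType G -> R) -> (forall x, 0 <= h x) ->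
  (\int[P]_x (h x * u x)%:E = \int[P]_x (h x * v x)%:E)%E.
Proof.
move=> Gm GI GT mu mv u01 v01 uv mh h0.
have mid : measurable_fun setT (id : T -> g_sigma_algebraType G).
  move=> _ /= C; rewrite setTI preimage_id; exact: (smallest_sub (@sigma_algebra_measurable _ T) Gm).
pose U : {finite_measure set T -> \bar R} := density_measure P mu u01.
pose V : {finite_measure set T -> \bar R} := density_measure P mv v01.
(* Two finite measures agreeing on a pi-system that contains the whole space agree on the
   sigma-algebra it generates. *)
have UV C : <<s G >> C -> U C = V C.
  apply: (@g_sigma_algebra_measure_unique _ _ _ G Gm (fun=> setT)) => //.
    by rewrite bigcup_const//; exists 0%N.
  by move=> _; rewrite -ge0_fin_numE// fin_num_measure.
have mhE : measurable_fun setT (EFin \o h : g_sigma_algebraType G -> \bar R).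
  exact/measurable_EFinP.
have mhT : measurable_fun setT (EFin \o h) by exact: (measurableT_comp mhE mid).
have h0E x : (0 <= (EFin \o h) x)%E by rewrite lee_fin.
under eq_integral do rewrite EFinM.
under [RHS]eq_integral do rewrite EFinM.
rewrite -(ge0_integral_density P mu u01 mhT h0E) -(ge0_integral_density P mv v01 mhT h0E).
(* Pushing forward along the identity restricts a measure to the sub-sigma-algebra, where [UV]
   identifies [U] with [V] and [h] is still measurable. *)
have int_id m : (\int[m : {measure set T -> \bar R}]_x (h x)%:E =
    \int[pushforward m (id : T -> g_sigma_algebraType G)]_x (h x)%:E)%E.
  by rewrite (ge0_integral_pushforward mid) ?preimage_setT//= => y _; exact: h0E.
rewrite !int_id.
by unshelve apply: eq_measure_integral => // C mC _; exact: UV.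
Qed.

(** The image under [Y] of [P] restricted to [E] is [k] times [nu]; the restriction is encoded as
    the measure of density [\1_E]. *)
Lemma ge0_integral_indic_law d (T : measurableType d) (R : realType)
    (P : {finite_measure set T -> \bar R}) (nu : {measure set R -> \bar R})
    (E : set T) (Y : T -> R) (k : R) (f : R -> R) :
  measurable E -> measurable_fun setT Y -> 0 <= k ->
  (forall S, measurable S -> P (E `&` Y @^-1` S) = (k%:E * nu S)%E) ->
  measurable_fun setT f -> (forall x, 0 <= f x) ->
  (\int[P]_x (f (Y x) * \1_E x)%:E = k%:E * \int[nu]_y (f y)%:E)%E.
Proof.
move=> mE mY k0 PE mf f0.
have m1 : measurable_fun setT (\1_E : T -> R) by exact: measurable_indic.
have b1 x : 0 <= (\1_E x : R) <= 1 by rewrite indicE; case: (_ \in _); rewrite ?ler01 ?lexx.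
have mfE : measurable_fun setT (EFin \o f) by exact/measurable_EFinP.
under eq_integral do rewrite EFinM.
rewrite -(ge0_integral_density P m1 b1 (h := EFin \o f \o Y)); last 2 first.
- exact: measurableT_comp.
- by move=> x; rewrite lee_fin.
have := @ge0_integral_pushforward _ _ _ _ _ _ mY (density_measure P m1 b1) setT (EFin \o f).
rewrite preimage_setT => <- //; last by move=> y _; rewrite lee_fin.
rewrite -(ge0_integral_mscale _ measurableT (NngNum k0)) //; last by move=> y _; rewrite lee_fin.
unshelve apply: eq_measure_integral => // S mS _.
rewrite /= /pushforward /mscale /= -PE// /density_measure integral_indic//.
by rewrite -[X in measurable X]setTI; exact: mY.
Qed.

(** * One-step and mixture bounds for exponential moments *)

(** One round of the Hoeffding-Azuma argument: [M] carries the past, and [X] has mean [m] under the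
    weight [M]. The chord of the exponential over [0, 1] is affine in [X], so these two integrals
    determine its own. *)
Lemma integral_chord_le d (T : measurableType d) (R : realType)
    (P : {measure set T -> \bar R}) (M X : T -> R) (m l e : R) :
  measurable_fun setT M -> measurable_fun setT X ->
  (forall x, 0 <= M x) -> (forall x, 0 <= X x <= 1) ->
  (\int[P]_x (M x)%:E = e%:E)%E ->
  (\int[P]_x (M x * X x)%:E = (m * e)%:E)%E ->
  (\int[P]_x (M x * expR (l * X x))%:E <= (e * (1 - m + m * expR l))%:E)%E.
Proof.
move=> mM mX M0 X01 Me MXe.
have mMX : measurable_fun setT (fun x => M x * X x) by exact: measurable_funM.
have mMX' : measurable_fun setT (fun x => M x * (1 - X x)).
  by apply: measurable_funM => //; exact: measurable_funB.
have MX0 x : 0 <= M x * X x by rewrite mulr_ge0//; case/andP: (X01 x).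
have MX'0 x : 0 <= M x * (1 - X x) by rewrite mulr_ge0// subr_ge0; case/andP: (X01 x).
have MX'e : (\int[P]_x (M x * (1 - X x))%:E = (e - m * e)%:E)%E.
  rewrite -[LHS](@addeK _ (m * e)%:E)// -[X in (_ + X - _)%E]MXe.
  rewrite -ge0_integralD//; do ?[exact/measurable_EFinP | by move=> x _; rewrite lee_fin].
  rewrite EFinB -Me; congr (_ - _)%E; apply: eq_integral => x _.
  by rewrite -EFinD -mulrDr subrK mulr1.
apply: (@le_trans _ _ (\int[P]_x ((M x * (1 - X x))%:E + (M x * X x * expR l)%:E)))%E.
  apply: ge0_le_integral => //.
  - by move=> x _; rewrite lee_fin mulr_ge0 ?expR_ge0.
  - apply/measurable_EFinP/measurable_funM => //; apply: measurableT_comp => //.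
    exact: measurable_funM.
  - apply: emeasurable_funD; apply/measurable_EFinP => //.
    exact: measurable_funM.
  - move=> x _; rewrite -EFinD lee_fin -mulrA -mulrDr ler_wpM2l//.
    exact: expR_chord.
rewrite ge0_integralD//; do ?[by apply/measurable_EFinP => //; exact: measurable_funM
  | by move=> x _; rewrite lee_fin// mulr_ge0 ?expR_ge0].
rewrite MX'e; under eq_integral do rewrite mulrC EFinM.
rewrite ge0_integralZl_EFin ?expR_ge0//;
  do ?[exact/measurable_EFinP | by move=> x _; rewrite lee_fin].
rewrite MXe -EFinM -EFinD lee_fin.
lra.
Qed.

(** A mixing variance [q] below [1 / v] would give [E exp (q S^2 / 2) <= (1 - v q)^(-1/2)]; the
    choice [q = 1 / (2 v)] gives the exponent and the constant here. *)
Lemma gaussian_mixture_le d (T : measurableType d) (R : realType)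
    (P : probability T R) (S : T -> R) (v : R) :
  0 < v -> measurable_fun setT S ->
  (forall l, (\int[P]_x (expR (l * S x))%:E <= (expR (v * l ^+ 2 / 2))%:E)%E) ->
  (\int[P]_x (expR (S x ^+ 2 / (4 * v)))%:E <= (Num.sqrt 2)%:E)%E.
Proof.
move=> v0 mS subg.
(* Tilting the normal law of variance [1 / (2 v)] by [exp (l y)] shifts its mean;
   multiplying it by the sub-Gaussian bound doubles its variance. *)
pose s := Num.sqrt (2 * v)^-1; pose s' := Num.sqrt v^-1.
have s0 : s != 0 by rewrite gt_eqF// sqrtr_gt0 invr_gt0 mulr_gt0.
have s'0 : s' != 0 by rewrite gt_eqF// sqrtr_gt0 invr_gt0.
have s2 : s ^+ 2 = (2 * v)^-1 by rewrite sqr_sqrtr// invr_ge0 mulr_ge0 ?ltW.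
have s'2 : s' ^+ 2 = v^-1 by rewrite sqr_sqrtr// invr_ge0 ltW.
have tilt y l : expR (l * y) * normal_pdf 0 s l =
    expR (y ^+ 2 / (4 * v)) * normal_pdf (y / (2 * v)) s l.
  rewrite !normal_pdfE// /normal_fun s2 mulrCA -expRD [RHS]mulrCA -expRD.
  by congr (_ * expR _); field; lra.
have widen l : expR (v * l ^+ 2 / 2) * normal_pdf 0 s l =
    Num.sqrt 2 * normal_pdf 0 s' l.
  rewrite !normal_pdfE// /normal_fun s2 s'2 mulrCA -expRD [RHS]mulrA.
  congr (_ * expR _); last by field; lra.
  rewrite /normal_peak s2 s'2.
  set y := (2 * v)^-1 * pi *+ 2.
  have -> : v^-1 * pi *+ 2 = 2 * y by rewrite /y; field; lra.
  rewrite sqrtrM// invfM mulrA divff ?mul1r//.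
(* By [tilt], the inner integral is the exponential of the square times the total mass of a shifted
   normal law. *)
have -> : (\int[P]_x (expR (S x ^+ 2 / (4 * v)))%:E = \int[P]_x
    \int[lebesgue_measure]_l (expR (l * S x) * normal_pdf 0 s l)%:E)%E.
  apply: eq_integral => x _; under [RHS]eq_integral do rewrite tilt EFinM.
  rewrite ge0_integralZl_EFin ?expR_ge0//.
  - by rewrite integral_normal_pdf mule1.
  - by move=> l _; rewrite lee_fin normal_pdf_ge0.
  - by apply/measurable_EFinP; exact: measurable_normal_pdf.
pose f (z : T * R) := (expR (z.2 * S z.1) * normal_pdf 0 s z.2)%:E.
have mf : measurable_fun setT f.
  apply/measurable_EFinP/measurable_funM.
    apply: measurableT_comp => //; apply: measurable_funM => //.
    exact: measurableT_comp.
  by apply: measurableT_comp => //; exact: measurable_normal_pdf.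
have f0 z : (0 <= f z)%E by rewrite lee_fin mulr_ge0 ?expR_ge0 ?normal_pdf_ge0.
rewrite (fubini_tonelli (m1 := P) (m2 := lebesgue_measure) f mf f0).
rewrite /f/=.
have mg : measurable_fun setT (fun l : R => (Num.sqrt 2 * normal_pdf 0 s' l)%:E).
  by apply/measurable_EFinP/measurable_funM => //; exact: measurable_normal_pdf.
apply: (@le_trans _ _ (\int[lebesgue_measure]_l (Num.sqrt 2 * normal_pdf 0 s' l)%:E))%E; last first.
  under eq_integral do rewrite EFinM.
  rewrite ge0_integralZl_EFin ?sqrtr_ge0//.
  - by rewrite integral_normal_pdf mule1.
  - by move=> l _; rewrite lee_fin normal_pdf_ge0.
  - by apply/measurable_EFinP; exact: measurable_normal_pdf.
apply: ge0_le_integral => //.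
- by move=> l _; apply: integral_ge0 => x _; rewrite lee_fin mulr_ge0 ?expR_ge0 ?normal_pdf_ge0.
- exact: (measurable_fun_fubini_tonelli_G (m1 := P) f mf f0).
- move=> l _; under eq_integral do rewrite EFinM muleC.
  rewrite ge0_integralZl_EFin ?normal_pdf_ge0//.
  + by rewrite muleC -widen [in leRHS]EFinM lee_wpmul2r// lee_fin normal_pdf_ge0.
  + by apply/measurable_EFinP/measurableT_comp => //; exact: measurable_funM.
Qed.

(** * The bandit process *)

Section reward.
Context (R : realType).

(* Rewards lie in [0, 1] only almost surely; clipping makes the bounds of the
   exponential moments pointwise. *)
Definition unit_clip (x : R) : R := \1_`[0, 1] x * x.

Lemma unit_clip01 x : 0 <= unit_clip x <= 1.
Proof.
rewrite /unit_clip indicE; case: (boolP (x \in _)) => [|_]; rewrite ?mul0r ?ler01 ?lexx//.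
by rewrite inE/= in_itv/= mul1r.
Qed.

Lemma unit_clip_id x : `[0, 1]%classic x -> unit_clip x = x.
Proof. by move=> x01; rewrite /unit_clip indicE mem_set// mul1r. Qed.

Lemma measurable_unit_clip : measurable_fun setT unit_clip.
Proof. exact: measurable_funM. Qed.

Variables (A : finType) (nu : A -> probability R R) (a : A).
Hypothesis nu01 : nu a `[0%R, 1%R]%classic = 1%E.

(** Clipping changes nothing [nu a]-almost everywhere, and the clipped integral is at most 1, so the
    [fine] in [rmean] loses nothing. *)
Lemma integral_unit_clip : (\int[nu a]_x (unit_clip x)%:E = (rmean nu a)%:E)%E.
Proof.
have -> : rmean nu a = fine (\int[nu a]_x (unit_clip x)%:E)%E.
  congr fine; apply: ae_eq_integral => //.
  - by apply/measurable_EFinP; exact: measurable_unit_clip.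
  - exists (~` `[0%R, 1%R]); split.
    + exact: measurableC.
    + by apply: etrans (probability_setC (nu a) (measurable_itv _)) _; rewrite nu01 subee.
    + by move=> x /= xP x01; apply: xP => _; rewrite unit_clip_id.
rewrite fineK// ge0_fin_numE; last first.
  by apply: integral_ge0 => x _; rewrite lee_fin; case/andP: (unit_clip01 x).
apply: (@le_lt_trans _ _ (\int[nu a]_x (cst 1%E x))%E); last first.
  by rewrite integral_cst//= mul1e; apply: le_lt_trans (probability_le1 _ measurableT) _; rewrite ltry.
apply: ge0_le_integral => //.
- by move=> x _; rewrite lee_fin; case/andP: (unit_clip01 x).
- by apply/measurable_EFinP; exact: measurable_unit_clip.
- by move=> x _; rewrite lee_fin; case/andP: (unit_clip01 x).
Qed.

Lemma rmean01 : 0 <= rmean nu a <= 1.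
Proof.
rewrite -!lee_fin -integral_unit_clip integral_ge0/=; last first.
  by move=> x _; rewrite lee_fin; case/andP: (unit_clip01 x).
apply: (@le_trans _ _ (\int[nu a]_x (cst 1%E x))%E); last first.
  by rewrite integral_cst//= mul1e; exact: probability_le1.
apply: ge0_le_integral => //.
- by move=> x _; rewrite lee_fin; case/andP: (unit_clip01 x).
- by apply/measurable_EFinP; exact: measurable_unit_clip.
- by move=> x _; rewrite lee_fin; case/andP: (unit_clip01 x).
Qed.

End reward.

Lemma measurable_fun_inv_gt0 d (T : measurableType d) (R : realType) (f : T -> R) :
  (forall x, 0 < f x) -> measurable_fun setT f ->
  measurable_fun setT (fun x => (f x)^-1).
Proof.
move=> f0 mf.
have -> : (fun x => (f x)^-1) = (fun y => y `^ (- 1)) \o f.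
  by apply/funext => x /=; rewrite powR_inv1// ltW.
by apply: measurableT_comp => //; exact: measurable_powR.
Qed.

Section bandit.
Context d (Omega : measurableType d) (R : realType) (A : finType).
Variables (P : probability Omega R) (nu : A -> probability R R)
  (pol : nat -> Omega -> A -> R) (Acts : nat -> Omega -> A)
  (Rew : nat -> Omega -> R) (t : nat) (eps : R).
Hypotheses (nu01 : forall a, nu a `[0%R, 1%R]%classic = 1%E)
  (bandit : bandit_process P nu pol Acts Rew t)
  (eps_gt0 : 0 < eps)
  (pol_ge : forall n w a, (n < t)%N -> eps <= pol n w a).

Local Notation F := (cylinder Acts Rew).
Local Notation history n := (g_sigma_algebraType (F n)).

Lemma cylinder_setI n : setI_closed (F n).
Proof.
move=> _ _ [D1 [S1 [mS1 ->]]] [D2 [S2 [mS2 ->]]].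
exists (fun m => D1 m :&: D2 m), (fun m => S1 m `&` S2 m); split.
  by move=> m; exact: measurableI.
apply/seteqP; split => w /=.
  by move=> [H1 H2] m mn; have [? ?] := H1 m mn; have [? ?] := H2 m mn; rewrite inE; split; [apply/andP|].
by move=> H; split=> m mn; have [] := H m mn; rewrite inE => /andP[? ?] [].
Qed.

Lemma cylinder_setT n : F n setT.
Proof.
exists (fun=> finset.setTfor A), (fun=> setT); split=> //.
by apply/seteqP; split => w //= _ m _; rewrite inE.
Qed.

Lemma sub_cylinder m n : (m <= n)%N -> F m `<=` F n.
Proof.
move=> mn _ [D [S [mS ->]]].
(* Rounds from [m] on are left unconstrained. *)
exists (fun k => if (k < m)%N then D k else finset.setTfor A),
  (fun k => if (k < m)%N then S k else setT); split.
  by move=> k; case: ifP.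
apply/seteqP; split => w /= H k.
  by move=> kn; case: ifPn => km; [exact: H|rewrite inE].
by move=> km; have := H k (leq_trans km mn); rewrite km.
Qed.

Lemma measurable_action n a : (n < t)%N -> measurable (Acts n @^-1` [set a]).
Proof. by move=> /bandit[]. Qed.

Lemma measurable_reward n : (n < t)%N -> measurable_fun setT (Rew n).
Proof. by move=> /bandit[]. Qed.

Lemma cylinder_measurable n : (n <= t)%N -> F n `<=` measurable.
Proof.
move=> nt _ [D [S [mS ->]]].
have -> : [set w | forall m, (m < n)%N -> Acts m w \in D m /\ S m (Rew m w)] =
    \bigcap_(m in `I_n) (\bigcup_(a in [set a | a \in D m]) (Acts m @^-1` [set a])
       `&` (Rew m @^-1` S m)).
  apply/seteqP; split => w /= H m mn.
    by have [? ?] := H m mn; split => //; exists (Acts m w).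
  by have [[a /= aD Aa] ?] := H m mn; rewrite Aa.
apply: bigcap_measurableType => m mn; rewrite /= in mn.
have mt := leq_trans mn nt.
apply: measurableI.
  apply: fin_bigcup_measurable; first exact: finite_finset.
  by move=> a _; exact: measurable_action.
by rewrite -[X in measurable X]setTI; exact: measurable_reward.
Qed.

Lemma history_measurable_action m n a : (m < n)%N ->
  measurable (Acts m @^-1` [set a] : set (history n)).
Proof.
move=> mn; apply: sub_sigma_algebra.
exists (fun k => if k == m then finset.set1 a else finset.setTfor A), (fun=> setT); split => //.
apply/seteqP; split => w /=.
  by move=> Aa k _; case: ifPn => [/eqP ->|_]; rewrite inE// Aa.
by move=> /(_ m mn)[]; rewrite eqxx inE => /eqP.
Qed.

Lemma history_measurable_reward m n : (m < n)%N ->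
  measurable_fun setT (Rew m : history n -> R).
Proof.
move=> mn _ B mB; rewrite setTI; apply: sub_sigma_algebra.
exists (fun=> finset.setTfor A), (fun k => if k == m then B else setT); split.
  by move=> k; case: ifP.
apply/seteqP; split => w /=.
  by move=> Bm k _; rewrite inE; case: ifPn => [/eqP ->|].
by move=> /(_ m mn)[_]; rewrite eqxx.
Qed.

Lemma history_measurable_policy m n a : (m <= n)%N -> (m < t)%N ->
  measurable_fun setT (fun w : history n => pol m w a).
Proof.
move=> mn /bandit[_ _ _ mpol _] _ B mB; rewrite setTI.
exact: (sub_sigma_algebra2 (sub_cylinder mn)) (mpol _ _ mB).
Qed.

Lemma history_measurableT n (f : Omega -> R) : (n <= t)%N ->
  measurable_fun setT (f : history n -> R) -> measurable_fun setT f.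
Proof.
move=> nt mf _ B mB; rewrite setTI.
have := mf measurableT B mB; rewrite setTI.
exact: (smallest_sub (@sigma_algebra_measurable _ Omega) (cylinder_measurable nt)).
Qed.

(** * Exponential moments for a fixed action *)

Variable a : A.

(** Dividing by [pol n w a] rather than by the probability of the action played gives the same value
    on the event of the indicator, and makes the denominator a function of the past. *)
Definition IS_term (n : nat) (w : Omega) : R :=
  \1_(Acts n @^-1` [set a]) w * (unit_clip (Rew n w) / pol n w a).

Local Notation r := (rmean nu a).

(** The sum stops before round [n], so this is measurable for the history available at that
    round. *)
Definition exp_dev (l : R) (n : nat) (w : Omega) : R :=
  expR (l * \sum_(m < n) (IS_term m w - r)).

Lemma pol_gt0 n w : (n < t)%N -> 0 < pol n w a.
Proof. by move=> nt; exact: lt_le_trans (pol_ge w a nt). Qed.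

Lemma pol_le1 n w : (n < t)%N -> pol n w a <= 1.
Proof.
move=> /bandit[_ _ polP _ _]; have [p0 <-] := polP w.
by rewrite (bigD1 a)//= lerDl sumr_ge0.
Qed.

Lemma measurable_policy n : (n < t)%N ->
  measurable_fun setT (fun w => pol n w a).
Proof.
move=> nt; apply: (history_measurableT (ltnW nt)).
exact: history_measurable_policy (leqnn n) nt.
Qed.

Lemma IS_term01 n w : (n < t)%N -> 0 <= eps * IS_term n w <= 1.
Proof.
move=> nt; have p0 := pol_gt0 w nt; have /andP[c0 c1] := unit_clip01 (Rew n w).
rewrite /IS_term indicE; case: (_ \in _); last by rewrite mul0r mulr0 lexx ler01.
rewrite mul1r mulr_ge0 ?divr_ge0 ?(ltW p0) ?(ltW eps_gt0)//= mulrA ler_pdivrMr// mul1r.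
by rewrite (le_trans _ (pol_ge w a nt))// ler_piMr// ltW.
Qed.

Lemma history_measurable_IS_term m n : (m < n)%N -> (m < t)%N ->
  measurable_fun setT (IS_term m : history n -> R).
Proof.
move=> mn mt; apply: measurable_funM.
  by apply: measurable_indic; exact: history_measurable_action.
apply: measurable_funM.
  apply: measurableT_comp; first exact: measurable_unit_clip.
  exact: history_measurable_reward.
apply: measurable_fun_inv_gt0; first by move=> w; exact: pol_gt0.
exact: history_measurable_policy (ltnW mn) mt.
Qed.

Lemma history_measurable_exp_dev l n : (n <= t)%N ->
  measurable_fun setT (exp_dev l n : history n -> R).
Proof.
move=> nt; apply: measurableT_comp => //; apply: measurable_funM => //.
apply: measurable_sum => m; apply: measurable_funB => //.
exact: history_measurable_IS_term (leq_trans _ nt).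
Qed.

(** The process law factors over the past event [C]: on [C] and [Acts n = a], the reward has law
    [nu a] scaled by the integral of the policy over [C]. Integrating the clipped reward brings out
    the mean. *)
Lemma integral_cylinder_reward n C : (n < t)%N -> F n C ->
  (\int[P]_(w in C) (\1_(Acts n @^-1` [set a]) w * unit_clip (Rew n w))%:E =
   \int[P]_(w in C) (r * pol n w a)%:E)%E.
Proof.
move=> nt FC; have [mact mrew polP mpol law] := bandit nt.
have mC : measurable C by exact: (cylinder_measurable (ltnW nt)).
have mD : measurable (Acts n @^-1` [set a]) by exact: measurable_action.
have pol0 w : 0 <= pol n w a by exact/ltW/pol_gt0.
have pol1 w : pol n w a <= 1 by exact: pol_le1.
have mpolT := measurable_policy nt.
have /andP[r0 _] := rmean01 (nu01 a).
have polC : (\int[P]_(w in C) (pol n w a)%:E)%E \is a fin_num.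
  rewrite ge0_fin_numE; last by apply: integral_ge0 => w _; rewrite lee_fin.
  apply: (@le_lt_trans _ _ (\int[P]_(w in C) (cst 1%E w))%E).
    apply: ge0_le_integral => //.
    - by move=> w _; rewrite lee_fin.
    - by apply: measurable_funTS; exact/measurable_EFinP.
    - by move=> w _; rewrite lee_fin.
  by rewrite integral_cst//= mul1e; apply: le_lt_trans (probability_le1 _ mC) _; rewrite ltry.
have mCD : measurable (C `&` Acts n @^-1` [set a]) by exact: measurableI.
have k0 : 0 <= fine (\int[P]_(w in C) (pol n w a)%:E)%E.
  by apply/fine_ge0/integral_ge0 => w _; rewrite lee_fin.
have clip0 x : 0 <= unit_clip x :> R by case/andP: (unit_clip01 x).
have lawC S : measurable S -> P (C `&` Acts n @^-1` [set a] `&` Rew n @^-1` S) =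
    ((fine (\int[P]_(w in C) (pol n w a)%:E))%:E * nu a S)%E.
  by move=> mS; rewrite fineK//; exact: law.
have := ge0_integral_indic_law mCD mrew k0 lawC (@measurable_unit_clip R) clip0.
rewrite fineK// integral_unit_clip// => h.
under [RHS]eq_integral do rewrite EFinM.
rewrite ge0_integralZl_EFin//; first last.
- by apply: measurable_funTS; exact/measurable_EFinP.
- by move=> w _; rewrite lee_fin.
rewrite muleC -h [LHS]integral_mkcond; apply: eq_integral => w _.
rewrite patchE indicI/= !indicE; case: (w \in C); rewrite /= ?mul0r ?mulr0//.
by rewrite mul1r mulrC.
Qed.

(** Unbiasedness of importance sampling given the past, tested against [exp_dev]. The weight
    [1 / pol n w a] depends on the past, so it joins the test function; what remains on each side is
    bounded by 1 and has equal integrals over cylinders. *)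
Lemma integral_exp_devM l n : (n < t)%N ->
  (\int[P]_w (exp_dev l n w * IS_term n w)%:E =
   \int[P]_w (exp_dev l n w * r)%:E)%E.
Proof.
move=> nt; have [mact mrew polP mpol law] := bandit nt.
have pol0 w : 0 <= pol n w a by exact/ltW/pol_gt0.
have pol1 w : pol n w a <= 1 by exact: pol_le1.
have mpolT := measurable_policy nt.
have /andP[r0 r1] := rmean01 (nu01 a).
transitivity (\int[P]_w (exp_dev l n w / pol n w a *
    (\1_(Acts n @^-1` [set a]) w * unit_clip (Rew n w)))%:E)%E.
  by apply: eq_integral => w _; congr (_%:E); rewrite /IS_term; ring.
transitivity (\int[P]_w (exp_dev l n w / pol n w a * (r * pol n w a))%:E)%E; last first.
  apply: eq_integral => w _; congr (_%:E).
  by rewrite [r * _]mulrC mulrA divfK// gt_eqF// pol_gt0.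
apply: (ge0_integral_density_unique (G := F n) (c := 1)).
- exact: cylinder_measurable (ltnW nt).
- exact: cylinder_setI.
- exact: cylinder_setT.
- apply: measurable_funM; first by apply: measurable_indic; exact: measurable_action.
  by apply: measurableT_comp => //; exact: measurable_unit_clip.
- exact: measurable_funM.
- move=> w; have /andP[c0 c1] := unit_clip01 (Rew n w).
  by rewrite indicE; case: (_ \in _); rewrite ?mul1r ?c0// mul0r lexx ler01.
- by move=> w; rewrite mulr_ge0//= mulr_ile1.
- by move=> C; exact: integral_cylinder_reward.
- apply: measurable_funM; first exact: history_measurable_exp_dev (ltnW nt).
  apply: measurable_fun_inv_gt0; first by move=> w; exact: pol_gt0.
  exact: history_measurable_policy (leqnn n) nt.
- by move=> w; rewrite divr_ge0 ?expR_ge0.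
Qed.

(** Induction on the rounds: each contributes a factor [expR ((l / eps) ^+ 2 / 8)]. The witness [e]
    records that the integral is finite. *)
Lemma exp_dev_le l n : (n <= t)%N ->
  exists2 e, (\int[P]_w (exp_dev l n w)%:E = e%:E)%E &
    e <= expR (n%:R / (4 * eps ^+ 2) * l ^+ 2 / 2).
Proof.
elim: n => [_|n IHn nt].
  exists 1; last by rewrite !mul0r expR0.
  under eq_integral do rewrite /exp_dev big_ord0 mulr0 expR0.
  by rewrite integral_cst//= probability_setT mule1.
have [e Me e_le] := IHn (ltnW nt).
have /andP[r0 r1] := rmean01 (nu01 a).
(* Evaluated at an arbitrary outcome: a lower bound on a probability is at most 1. *)
have eps1 : eps <= 1.
  exact: le_trans (pol_ge point a nt) (pol_le1 point nt).
have m01 : 0 <= eps * r <= 1 by rewrite mulr_ge0 ?(ltW eps_gt0)//= mulr_ile1// ltW.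
have M0 k w : 0 <= exp_dev l k w by exact: expR_ge0.
have mM k : (k <= t)%N -> measurable_fun setT (exp_dev l k).
  by move=> kt; exact: (history_measurableT kt (history_measurable_exp_dev l kt)).
have mX : measurable_fun setT (IS_term n).
  exact: (history_measurableT nt (history_measurable_IS_term (ltnSn n) nt)).
have MXe : (\int[P]_w (exp_dev l n w * (eps * IS_term n w))%:E = (eps * r * e)%:E)%E.
  under eq_integral do rewrite mulrCA EFinM.
  rewrite ge0_integralZl_EFin ?(ltW eps_gt0)//; first last.
  - by apply/measurable_EFinP; apply: measurable_funM => //; exact: mM (ltnW nt).
  - move=> w _; rewrite lee_fin mulr_ge0//.
    by have /andP[] := IS_term01 w nt; rewrite pmulr_rge0.
  rewrite integral_exp_devM//; under eq_integral do rewrite mulrC EFinM.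
  rewrite ge0_integralZl_EFin//; first last.
  - by apply/measurable_EFinP; exact: mM (ltnW nt).
  - by move=> w _; rewrite lee_fin.
  by rewrite Me -!EFinM mulrA.
have step : (\int[P]_w (exp_dev l n.+1 w)%:E <=
    (e * expR ((l / eps) ^+ 2 / 8))%:E)%E.
  (* Split off the centring and rescale the new term by [eps] into [0, 1], which replaces [l] by
     [l / eps]. *)
  have -> : (\int[P]_w (exp_dev l n.+1 w)%:E = (expR (- (l * r)))%:E *
      \int[P]_w (exp_dev l n w * expR (l / eps * (eps * IS_term n w)))%:E)%E.
    rewrite -ge0_integralZl_EFin ?expR_ge0//; first last.
    - apply/measurable_EFinP; apply: measurable_funM; first exact: mM (ltnW nt).
      by apply: measurableT_comp => //; do 2 apply: measurable_funM => //.
    - by move=> w _; rewrite lee_fin mulr_ge0 ?expR_ge0.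
    apply: eq_integral => w _; rewrite -EFinM; congr (_%:E).
    rewrite /exp_dev big_ord_recr/= -!expRD; congr expR.
    by field; rewrite gt_eqF.
  have meX : measurable_fun setT (fun w => eps * IS_term n w) by exact: measurable_funM.
  have h := @integral_chord_le _ _ _ P _ _ (eps * r) (l / eps) e
    (mM _ (ltnW nt)) meX (M0 n) (fun w => IS_term01 w nt) Me MXe.
  have c0 : (0 <= (expR (- (l * r)))%:E)%E by rewrite lee_fin expR_ge0.
  apply: (le_trans (lee_wpmul2l c0 h)).
  rewrite -EFinM lee_fin mulrCA ler_wpM2l//.
    by rewrite -lee_fin -Me; apply: integral_ge0 => w _; rewrite lee_fin.
  (* The linear term [l / eps * (eps * r)] cancels the centring [- (l * r)]. *)
  apply: le_trans (ler_wpM2l (expR_ge0 _) (bernoulli_mgf_le (l / eps) m01)) _.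
  by rewrite -expRD ler_expR le_eqVlt; apply/orP; left; apply/eqP; field; rewrite gt_eqF.
exists (fine (\int[P]_w (exp_dev l n.+1 w)%:E)%E).
  rewrite fineK// ge0_fin_numE; last by apply: integral_ge0 => w _; rewrite lee_fin.
  by apply: le_lt_trans step _; rewrite ltry.
rewrite -lee_fin fineK; last first.
  rewrite ge0_fin_numE; last by apply: integral_ge0 => w _; rewrite lee_fin.
  by apply: le_lt_trans step _; rewrite ltry.
apply: le_trans step _; rewrite lee_fin.
apply: le_trans (ler_wpM2r (expR_ge0 _) e_le) _.
rewrite -expRD ler_expR le_eqVlt; apply/orP; left; apply/eqP.
rewrite -natr1; field; rewrite gt_eqF//.
Qed.

End bandit.

(** * Deviation of the estimate after all rounds *)

Section deviation.
Context d (Omega : measurableType d) (R : realType) (A : finType).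
Variables (P : probability Omega R) (nu : A -> probability R R)
  (pol : nat -> Omega -> A -> R) (Acts : nat -> Omega -> A)
  (Rew : nat -> Omega -> R) (t : nat) (eps : R).
Hypotheses (nu01 : forall a, nu a `[0%R, 1%R]%classic = 1%E)
  (bandit : bandit_process P nu pol Acts Rew t)
  (eps_gt0 : 0 < eps)
  (pol_ge : forall n w a, (n < t)%N -> eps <= pol n w a)
  (t_gt0 : (0 < t)%N).

Definition IS_dev (a : A) (w : Omega) : R :=
  \sum_(n < t) (IS_term pol Acts Rew a n w - rmean nu a).

Lemma measurable_IS_dev a : measurable_fun setT (IS_dev a).
Proof.
apply: (history_measurableT bandit (leqnn t)).
apply: measurable_sum => n; apply: measurable_funB => //.
exact: (history_measurable_IS_term bandit eps_gt0 pol_ge a (ltn_ord n) (ltn_ord n)).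
Qed.

Lemma exp_sqr_IS_dev_le a :
  (\int[P]_w (expR (eps ^+ 2 / t%:R * IS_dev a w ^+ 2))%:E <= (Num.sqrt 2)%:E)%E.
Proof.
have t0 : 0 < t%:R :> R by rewrite ltr0n.
have v0 : 0 < t%:R / (4 * eps ^+ 2) by rewrite divr_gt0// mulr_gt0// exprn_gt0.
have -> : (\int[P]_w (expR (eps ^+ 2 / t%:R * IS_dev a w ^+ 2))%:E =
    \int[P]_w (expR (IS_dev a w ^+ 2 / (4 * (t%:R / (4 * eps ^+ 2)))))%:E)%E.
  by apply: eq_integral => w _; congr (expR _)%:E; field; rewrite !gt_eqF.
apply: gaussian_mixture_le => // [|l]; first exact: measurable_IS_dev.
have [e -> e_le] := exp_dev_le nu01 bandit eps_gt0 pol_ge a l (leqnn t).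
by rewrite lee_fin.
Qed.

(** Split by action because the process law describes a reward only jointly with the action
    played. *)
Definition reward_out_of_range : set Omega :=
  \big[setU/set0]_(n < t) \big[setU/set0]_(a : A)
    (Acts n @^-1` [set a] `&` Rew n @^-1` ~` `[0, 1]).

Lemma measurable_reward_out_of_range : measurable reward_out_of_range.
Proof.
apply: bigsetU_measurable => n _; apply: bigsetU_measurable => a _.
have [mact mrew _ _ _] := bandit (ltn_ord n).
apply: measurableI => //; rewrite -[X in measurable X]setTI; apply: mrew => //.
by apply: measurableC; exact: measurable_itv.
Qed.

Lemma reward_out_of_range0 : P reward_out_of_range = 0%E.
Proof.
apply: measure_negligible; first exact: measurable_reward_out_of_range.
rewrite /reward_out_of_range; elim/big_ind: _ => [||n _].
- exact: negligible_set0.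
- exact: negligibleU.
elim/big_ind: _ => [||a _].
- exact: negligible_set0.
- exact: negligibleU.
have [mact mrew _ _ law] := bandit (ltn_ord n).
have mI : measurable (~` `[0%R, 1%R] : set R) by apply: measurableC; exact: measurable_itv.
apply/negligibleP.
  by apply: measurableI => //; rewrite -[X in measurable X]setTI; exact: mrew.
have nu_out : nu a (~` `[0%R, 1%R]) = 0%E.
  by apply: etrans (probability_setC (nu a) (measurable_itv _)) _; rewrite nu01 subee.
(* With the whole space as past event, the law gives each piece a multiple of [nu a] of the
   complement of [0, 1]. *)
have := law _ a _ (cylinder_setT Acts Rew n) mI.
by rewrite setTI nu_out mule0.
Qed.

Lemma reward_in_range w n : (n < t)%N -> ~ reward_out_of_range w ->
  0 <= Rew n w <= 1.
Proof.
move=> nt; apply: contra_notP => Rn.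
rewrite /reward_out_of_range (bigD1 (Ordinal nt))//=; left.
rewrite (bigD1 (Acts n w))//=; left; split=> //=; by rewrite in_itv.
Qed.

(** Off the exceptional event clipping is the identity, so [IS_dev a w / t%:R] is the estimate minus
    the mean. *)
Lemma rbarB_rIS w (p : A -> R) : ~ reward_out_of_range w ->
  rbar nu p - rIS pol Acts Rew t w p =
  - (\sum_a p a * (IS_dev a w / t%:R)).
Proof.
move=> wR; rewrite /rbar /rIS -sumrB -sumrN; apply: eq_bigr => a _.
rewrite -mulrBr -[RHS]mulrN; congr (_ * _).
have t0 : t%:R != 0 :> R by rewrite pnatr_eq0 -lt0n.
rewrite /IS_dev sumrB sumr_const card_ord /rIS_act -(mulr_natr (rmean nu a)) mulrBl mulfK// opprB.
congr (_ - _); rewrite mulrC; congr (_ / _).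
apply: eq_bigr => n _; rewrite /IS_term indicE.
rewrite unit_clip_id; last by rewrite /= in_itv/=; exact: reward_in_range.
case: (eqVneq (Acts n w) a) => [<-|Aa].
  by rewrite mem_set// mul1r.
by rewrite memNset ?mul0r//= => /eqP; rewrite (negbTE Aa).
Qed.

End deviation.

(** * From exponential moments to the uniform bound *)

(** Nonnegativity of the variance of [f] under [p]. *)
Lemma sqr_mean_le (R : realType) (A : finType) (p f : A -> R) : is_policy p ->
  (\sum_a p a * f a) ^+ 2 <= \sum_a p a * f a ^+ 2.
Proof.
move=> [p0 p1]; set m := \sum_a p a * f a.
have : 0 <= \sum_a p a * (f a - m) ^+ 2 by apply: sumr_ge0 => a _; rewrite mulr_ge0 ?sqr_ge0.
have -> : \sum_a p a * (f a - m) ^+ 2 =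
    \sum_a p a * f a ^+ 2 - (\sum_a p a * f a) * (2 * m) + (\sum_a p a) * m ^+ 2.
  by rewrite !mulr_suml -sumrB -big_split/=; apply: eq_bigr => a _; ring.
by rewrite p1 -/m; lra.
Qed.

Lemma sqrt2_le_4pi3 (R : realType) : Num.sqrt 2 <= 4 * pi / 3 :> R.
Proof.
apply: (@le_trans _ _ 2); last by have := pi_ge2 R; lra.
rewrite -[leRHS]ger0_norm// -sqrtr_sqr; apply: ler_wsqrtr; lra.
Qed.

Theorem theorem1 (R : realType) (d : measure_display) (Omega : measurableType d)
  (P : probability Omega R) (A : finType) (t : nat)
  (nu : A -> probability R R) (pol : nat -> Omega -> A -> R)
  (Acts : nat -> Omega -> A) (Rew : nat -> Omega -> R)
  (Pi : set (A -> R)) (mu : A -> R) (eps beta : R) :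
  (0 < t)%N ->
  (forall a, nu a `[0%R, 1%R]%classic = 1%E) ->
  bandit_process P nu pol Acts Rew t ->
  (forall p, Pi p -> is_policy p) -> compact (Pi : set {ptws A -> R}) ->
  Pi mu ->
  0 < eps -> (forall n w a, (n < t)%N -> eps <= pol n w a) ->
  0 < beta < 1 ->
  exists E : set Omega, measurable E /\ ((1 - beta)%:E <= P E)%E /\
    forall w, E w -> forall p, Pi p -> (KL p mu < +oo)%E ->
      `| rbar nu p - rIS pol Acts Rew t w p |
        <= eps^-1 * Num.sqrt ((fine (KL p mu) + ln (4 * pi / (3 * beta))) / t%:R).
Proof.
move=> t0 nu01 bandit Pi_policy _ Pimu eps0 pol_ge /andP[beta0 beta1].
have [mu0 mu1] := Pi_policy mu Pimu.
have tR0 : 0 < t%:R :> R by rewrite ltr0n.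
pose S := IS_dev nu pol Acts Rew t.
pose W w := \sum_a mu a * expR (eps ^+ 2 / t%:R * S a w ^+ 2).
pose K : R := 4 * pi / 3.
have K0 : 0 < K by rewrite /K; have := pi_ge2 R; lra.
have mS a : measurable_fun setT (S a).
  exact: (measurable_IS_dev bandit eps0 pol_ge a).
have mexp a : measurable_fun setT (fun w => expR (eps ^+ 2 / t%:R * S a w ^+ 2)).
  by apply: measurableT_comp => //; apply: measurable_funM => //; exact: measurable_funX.
have mW : measurable_fun setT W.
  by apply: measurable_sum => a; exact: measurable_funM.
(* Positivity of [W] lets Markov's inequality drop the absolute value, and later makes the logarithm
   monotone. *)
have W1 w : 1 <= W w.
  rewrite -mu1; apply: ler_sum => a _; rewrite ler_peMr//.
  by rewrite -expR0 ler_expR mulr_ge0 ?divr_ge0 ?sqr_ge0.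
have W_le : (\int[P]_w (W w)%:E <= K%:E)%E.
  apply: (@le_trans _ _ (Num.sqrt 2)%:E); last by rewrite lee_fin sqrt2_le_4pi3.
  under eq_integral do rewrite -sumEFin.
  rewrite ge0_integral_sum//; last 2 first.
  - by move=> a; apply/measurable_EFinP; exact: measurable_funM.
  - by move=> a w _; rewrite lee_fin mulr_ge0 ?expR_ge0.
  apply: (@le_trans _ _ (\sum_a (mu a * Num.sqrt 2)%:E)%E); last first.
    by rewrite sumEFin -mulr_suml mu1 mul1r.
  apply: lee_sum => a _; under eq_integral do rewrite EFinM.
  rewrite ge0_integralZl_EFin//; last first.
  - exact/measurable_EFinP.
  rewrite EFinM lee_wpmul2l ?lee_fin//.
  exact: (exp_sqr_IS_dev_le nu01 bandit eps0 pol_ge t0 a).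
pose Big := [set w | K / beta <= W w].
have mBig : measurable Big.
  by rewrite -[Big]setTI; apply: measurable_fun_le.
pose Bad := reward_out_of_range Acts Rew t.
have mBad : measurable Bad by exact: (measurable_reward_out_of_range bandit).
have PBad : (P Bad <= 0)%E by rewrite (reward_out_of_range0 nu01 bandit).
have KB0 : 0 < K / beta by rewrite divr_gt0.
have PBig : (P Big <= beta%:E)%E.
  have mWE : measurable_fun setT (EFin \o W) by exact/measurable_EFinP.
  (* Markov's inequality at level [K / beta], where the mean bound [K] leaves probability [beta]. *)
  have := @le_integral_abse _ _ _ P setT measurableT (EFin \o W) (K / beta) mWE KB0.
  have -> : setT `&` [set x | ((K / beta)%:E <= `|(EFin \o W) x|)%E] = Big.
    rewrite setTI; apply: eq_set => w /=.
    by rewrite lee_fin ger0_norm// (le_trans ler01 (W1 w)).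
  have -> : (\int[P]_w `|(EFin \o W) w| = \int[P]_w (W w)%:E)%E.
    by apply: eq_integral => w _ /=; rewrite ger0_norm// (le_trans ler01 (W1 w)).
  move=> /le_trans/(_ W_le);
  rewrite -lee_pdivlMl// -EFinM.
  by have -> : (K / beta)^-1 * K = beta by field; rewrite !gt_eqF.
(* The event involves only [mu] and the data, which makes the bound uniform in [p]. *)
exists (~` (Bad `|` Big)); split; last split.
- by apply: measurableC; exact: measurableU.
- rewrite probability_setC; last exact: measurableU.
  rewrite EFinB leeB//.
  apply: le_trans (measureU2 _ mBad mBig) _.
  by apply: le_trans (leeD PBad PBig) _; rewrite add0e.
move=> w; rewrite setCU => -[wBad /negP]; rewrite -ltNge => WK p Pip KLp.
have pP := Pi_policy p Pip.
rewrite (rbarB_rIS nu pol t0 p wBad) normrN.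
set D := \sum_a _.
have D2 : D ^+ 2 <= \sum_a p a * (S a w / t%:R) ^+ 2 by exact: sqr_mean_le.
have := donsker_varadhan (fun a => eps ^+ 2 / t%:R * S a w ^+ 2) pP (Pi_policy mu Pimu) KLp.
have -> : \sum_a p a * (eps ^+ 2 / t%:R * S a w ^+ 2) =
    eps ^+ 2 * t%:R * \sum_a p a * (S a w / t%:R) ^+ 2.
  by rewrite mulr_sumr; apply: eq_bigr => a _; field; rewrite gt_eqF.
rewrite -/(W w) => DV.
have lnW : ln (W w) <= ln (4 * pi / (3 * beta)).
  have -> : 4 * pi / (3 * beta) = K / beta by rewrite /K; field; rewrite gt_eqF.
  by rewrite ler_ln ?posrE// ?ltW// (lt_le_trans ltr01 (W1 w)).
have e2t0 : 0 < eps ^+ 2 * t%:R by rewrite mulr_gt0// exprn_gt0.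
(* Both sides become square roots, leaving [D ^+ 2] to compare with [eps ^- 2] times the
   radicand. *)
rewrite -[leLHS]ger0_norm// -sqrtr_sqr real_normK ?num_real//.
rewrite -[eps^-1]ger0_norm ?invr_ge0 ?(ltW eps0)// -sqrtr_sqr -sqrtrM ?sqr_ge0//.
apply: ler_wsqrtr; rewrite exprVn mulrA ler_pdivlMr// ler_pdivlMl ?exprn_gt0//.
apply: le_trans (lerD (lexx _) lnW); apply: le_trans DV.
by rewrite mulrA [leLHS]mulrAC ler_wpM2l// ltW.
Qed.
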